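(* Let $K$ be a field of characteristic $0$, let $X=(x_{ij})_{i,j=1}^n$ be a square matrix of commuting indeterminates, and let $\partial=(\partial/\partial x_{ij})_{i,j=1}^n$ be the corresponding matrix of partial derivatives; work in the Weyl algebra $A_{n\times n}(K)$ generated by the $x_{ij}$ and $\partial/\partial x_{ij}$. Then, for any $I,J\subseteq[n]$ of cardinality $|I|=|J|=r$ (with $1\le r\le n$), writing $I=\{i_1<\dots<i_r\}$ and $J=\{j_1<\dots<j_r\}$, and any nonnegative integer $s$, we have the following identity in $A_{n\times n}(K)$: $$\sum_{L\subseteq[n],\,|L|=r}\bigl(\det\,(X^{\mathrm T})_{IL}\bigr)\bigl(\det\partial_{LJ}\bigr)(\det X)^s=(\det X)^s\,\text{col-det}\bigl[(X^{\mathrm T}\partial)_{IJ}+Q_{\rm col}(s)\bigr],$$ where $Q_{\rm col}(s)_{\alpha\beta}=(s+r-\beta)\,\delta_{i_\alpha j_\beta}$ for $1\le\alpha,\beta\le r$. In particular, for $I=J=[n]$ we have $$(\det X)(\det\partial)(\det X)^s=(\det X)^s\,\text{col-det}(X^{\mathrm T}\partial+\Delta),$$ where $\Delta_{ij}=(s+n-j)\,\delta_{ij}$.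
   Context: Notation: $[n]=\{1,\dots,n\}$; $M_{IJ}$ is the submatrix of $M$ with rows $I$ and columns $J$ kept in their original (increasing) order. The Weyl algebra $A_{n\times n}(K)$ is the algebra of polynomial-coefficient differential operators in the $n^2$ variables $x_{ij}$; juxtaposition denotes the product (composition of operators), so $(\det X)^s$ on the left-hand side is the multiplication operator and not a function to which $\det\partial$ has been applied. For an $r\times r$ matrix $M$ over a ring, $\text{col-det}\,M=\sum_{\sigma\in\mathcal S_r}\mathrm{sgn}(\sigma)\,M_{\sigma(1)1}M_{\sigma(2)2}\cdots M_{\sigma(r)r}$; $\det$ is the usual determinant, used for matrices with commuting entries. *)

(* Defs.v *)
From HB Require Import structures.
From mathcomp Require Import all_boot all_order all_fingroup all_algebra.
From mathcomp Require Import boolp.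
From mathcomp Require Import mpoly.

Set Implicit Arguments.
Unset Strict Implicit.
Unset Printing Implicit Defensive.

Import GRing.Theory.

Local Open Scope ring_scope.

(* The [n * n] variables are indexed by [mxvec_index i j], which stands for   *)
(* the pair [(i, j)].                                                         *)
Section WeylAlgebra.

Variables (K : fieldType) (n : nat).

Local Notation P := {mpoly K[n * n]}.

(* The differential operators with polynomial coefficients: the smallest set  *)
(* of maps containing multiplications by polynomials and the partial          *)
(* derivatives, and closed under sum and composition.                         *)
Inductive is_diffop : (P -> P) -> Prop :=
| diffop_mul (f : P) : is_diffop (fun p => f * p)
| diffop_deriv (i j : 'I_n) : is_diffop (mderiv (mxvec_index i j))
| diffop_add (u v : P -> P) :
    is_diffop u -> is_diffop v -> is_diffop (fun p => u p + v p)
| diffop_comp (u v : P -> P) :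
    is_diffop u -> is_diffop v -> is_diffop (fun p => u (v p)).

(* Over a field of characteristic 0, this concrete algebra of operators is    *)
(* the Weyl algebra; its product is composition.                              *)
Record weyl := Weyl { weyl_op :> P -> P; weyl_opP : is_diffop weyl_op }.

Lemma weylP (u v : weyl) : (forall p, u p = v p) -> u = v.
Proof.
case: u v => [u uP] [v vP] /= /funext uv; rewrite -uv in vP *.
by rewrite (Prop_irrelevance uP vP).
Qed.

Lemma is_diffop_linear (u : P -> P) : is_diffop u -> linear u.
Proof.
elim=> [f|i j|{}u v _ lu _ lv|{}u v _ lu _ lv] a p q.
- by rewrite mulrDr scalerAr.
- by rewrite linearP.
- by rewrite lu lv scalerDr addrACA.
- by rewrite lv lu.
Qed.

HB.instance Definition _ (u : weyl) :=
  GRing.isLinear.Build K P P *:%R (weyl_op u) (is_diffop_linear (weyl_opP u)).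

HB.instance Definition _ := gen_eqMixin weyl.
HB.instance Definition _ := gen_choiceMixin weyl.

Definition weyl_mulop (f : P) : weyl := Weyl (diffop_mul f).
Definition weyl_add (u v : weyl) : weyl :=
  Weyl (diffop_add (weyl_opP u) (weyl_opP v)).
Definition weyl_mul (u v : weyl) : weyl :=
  Weyl (diffop_comp (weyl_opP u) (weyl_opP v)).
Definition weyl_scale (a : K) (u : weyl) : weyl := weyl_mul (weyl_mulop a%:MP) u.
Definition weyl_opp (u : weyl) : weyl := weyl_mul (weyl_mulop (-1)) u.

Fact weyl_addA : associative weyl_add.
Proof. by move=> u v w; apply: weylP => p /=; rewrite addrA. Qed.

Fact weyl_addC : commutative weyl_add.
Proof. by move=> u v; apply: weylP => p /=; rewrite addrC. Qed.

Fact weyl_add0 : left_id (weyl_mulop 0) weyl_add.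
Proof. by move=> u; apply: weylP => p /=; rewrite mul0r add0r. Qed.

Fact weyl_addN : left_inverse (weyl_mulop 0) weyl_opp weyl_add.
Proof. by move=> u; apply: weylP => p /=; rewrite mulN1r addNr mul0r. Qed.

HB.instance Definition _ :=
  GRing.isZmodule.Build weyl weyl_addA weyl_addC weyl_add0 weyl_addN.

Fact weyl_mulA : associative weyl_mul.
Proof. by move=> u v w; apply: weylP. Qed.

Fact weyl_mul1l : left_id (weyl_mulop 1) weyl_mul.
Proof. by move=> u; apply: weylP => p /=; rewrite mul1r. Qed.

Fact weyl_mul1r : right_id (weyl_mulop 1) weyl_mul.
Proof. by move=> u; apply: weylP => p /=; rewrite mul1r. Qed.

Fact weyl_mulDl : left_distributive weyl_mul weyl_add.
Proof. by move=> u v w; apply: weylP. Qed.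

Fact weyl_mulDr : right_distributive weyl_mul weyl_add.
Proof. by move=> u v w; apply: weylP => p /=; rewrite linearD. Qed.

Fact weyl_oner_neq0 : weyl_mulop 1 != 0.
Proof.
apply/eqP => /(congr1 (fun u : weyl => u 1)) /= /eqP.
by rewrite mul1r mul0r oner_eq0.
Qed.

HB.instance Definition _ := GRing.Zmodule_isNzRing.Build weyl
  weyl_mulA weyl_mul1l weyl_mul1r weyl_mulDl weyl_mulDr weyl_oner_neq0.

Fact weyl_scaleA a b (u : weyl) :
  weyl_scale a (weyl_scale b u) = weyl_scale (a * b) u.
Proof. by apply: weylP => p /=; rewrite mpolyCM mulrA. Qed.

Fact weyl_scale1 : left_id 1 weyl_scale.
Proof. by move=> u; apply: weylP => p /=; rewrite mul1r. Qed.

Fact weyl_scaleDr : right_distributive weyl_scale +%R.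
Proof. by move=> a u v; apply: weylP => p /=; rewrite mulrDr. Qed.

Fact weyl_scaleDl (u : weyl) :
  {morph weyl_scale^~ u : a b / a + b}.
Proof. by move=> a b; apply: weylP => p /=; rewrite mpolyCD mulrDl. Qed.

HB.instance Definition _ := GRing.Zmodule_isLmodule.Build K weyl
  weyl_scaleA weyl_scale1 weyl_scaleDr weyl_scaleDl.

Fact weyl_scaleAl a (u v : weyl) : a *: (u * v) = (a *: u) * v.
Proof. exact: weylP. Qed.

HB.instance Definition _ := GRing.Lmodule_isLalgebra.Build K weyl weyl_scaleAl.

Fact weyl_scaleAr a (u v : weyl) : a *: (u * v) = u * (a *: v).
Proof. by apply: weylP => p /=; rewrite !mul_mpolyC linearZ. Qed.

HB.instance Definition _ := GRing.Lalgebra_isAlgebra.Build K weyl weyl_scaleAr.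

Definition weylX : 'M[weyl]_n :=
  \matrix_(i, j) weyl_mulop 'X_(mxvec_index i j).

Definition weylD : 'M[weyl]_n :=
  \matrix_(i, j) Weyl (diffop_deriv i j).

End WeylAlgebra.

(* The [r]-element subsets of [{0, ..., n.-1}].                               *)
Definition rsubset (n r : nat) := {L : {set 'I_n} | #|L| == r}.

(* The [a]-th element of [L] in increasing order.                             *)
Definition rsubset_nth n r (L : rsubset n r) (a : 'I_r) : 'I_n :=
  enum_val (cast_ord (esym (eqP (valP L))) a).

Definition minor_mx (R : Type) n r (L M : rsubset n r) (A : 'M[R]_n) :
    'M[R]_r :=
  mxsub (rsubset_nth L) (rsubset_nth M) A.

(* The factors of the product over [b] are taken in increasing order of [b].  *)
Definition col_det (R : pzRingType) r (A : 'M[R]_r) : R :=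
  \sum_(s : 'S_r) (-1) ^+ s * \prod_(b < r) A (s b) b.

(* The column index [b] starts from 0, hence [b.+1] for the usual index; the  *)
(* subtraction does not truncate, as [b < r].                                 *)
Definition Qcol (R : pzRingType) n r (I J : rsubset n r) (s : nat) : 'M[R]_r :=
  \matrix_(a, b)
    ((s + r - b.+1)%N%:R *+ (rsubset_nth I a == rsubset_nth J b)).

Definition Delta_mx (R : pzRingType) n (s : nat) : 'M[R]_n :=
  \matrix_(i, j) ((s + n - j.+1)%N%:R *+ (i == j)).

(* Main.v *)
Require Import Defs.
From HB Require Import structures.
From mathcomp Require Import all_boot all_order all_fingroup all_algebra.
From mathcomp Require Import boolp.
From mathcomp Require Import mpoly.

Set Implicit Arguments.
Unset Strict Implicit.
Unset Printing Implicit Defensive.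

Import GRing.Theory.

Local Open Scope ring_scope.

(** Write [E = X^T *m D] for the matrix of polarization operators.  The
    identity combines two facts.

    The first is the case [s = 0], a Capelli identity of Cauchy-Binet type:
    the sum of the products of minors is the column determinant of [E] with
    [r - b.+1] added in column [b] where the row and column labels agree.
    The sum of minors is a normal-ordered object, in which every variable
    stands to the left of every derivative.  Expand the column determinant
    over permutations [t] and put its factors into normal order one at a time,
    from the last column to the first.  Moving [E (i (t a)) (j a)] through the
    normal-ordered product of the columns [b > a] produces, besides the wanted
    product, one term for each [b > a] with [j a = i (t b)], and in it the
    indices [i (t a)] and [i (t b)] are exchanged.  Summed over [t] with signs,
    precomposing [t] with the transposition of [a] and [b] turns it into
    minus the term without exchange.  There are [r - a.+1] columns [b > a], so
    the total cancels the constants of column [a] exactly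
    ([polarization_normal_prod], [capelli_normal_prod]).  The fully
    normal-ordered sum is a sum over all functions [l] from columns to
    [{0, ..., n.-1}] ([normal_prodE]); for fixed [l] its signed sum of
    variables is a determinant, which vanishes unless [l] is injective, and
    the injective [l] are the pairs of a subset and a permutation
    ([cauchy_binet]).

    The second fact is that [E i j], a first-order differential operator
    without constant term, sends [\det X] to [\det X *+ (i == j)] by cofactor
    expansion, whence [E i j] passes through [\det X ^+ s] at the cost of the
    constant [s *+ (i == j)] ([polarization_det_exp]).  Doing this in each
    factor of the column determinant raises every constant [r - b.+1] to
    [s + r - b.+1] ([capelli_det_exp]). *)

(** * Products in noncommutative rings and sums over finite functions *)

Lemma perm_prod_comm (R : pzSemiRingType) (I : eqType) (F : I -> R)
    (s t : seq I) :
  (forall i j, GRing.comm (F i) (F j)) -> perm_eq s t ->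
  \prod_(i <- s) F i = \prod_(i <- t) F i.
Proof.
move=> Fcomm; elim: s t => [|a s IHs] t est.
  by move: est; rewrite perm_sym => /perm_nilP ->.
have a_t : a \in t by rewrite -(perm_mem est) mem_head.
case/splitPr: a_t est => p q est.
rewrite big_cons (IHs (p ++ q)); last first.
  by move: est; rewrite -[a :: q]cat1s perm_sym perm_catCA perm_cons perm_sym.
rewrite !big_cat big_cons /= !mulrA; congr (_ * _).
by apply: commr_prod => i _; apply: Fcomm.
Qed.

Lemma prodr_intertwine (R : pzSemiRingType) (I : Type) (s : seq I)
    (A B : I -> R) (d : R) :
  (forall i, A i * d = d * B i) ->
  \prod_(i <- s) A i * d = d * \prod_(i <- s) B i.
Proof.
move=> AdB; elim: s => [|i s IHs]; first by rewrite !big_nil mul1r mulr1.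
by rewrite !big_cons -mulrA IHs mulrA AdB mulrA.
Qed.

Lemma big_ffun_ordS (V : nmodType) (T : finType) (k : nat)
    (phi : {ffun 'I_k.+1 -> T} -> V) :
  \sum_(l : {ffun 'I_k.+1 -> T}) phi l =
  \sum_(x : T) \sum_(l : {ffun 'I_k -> T})
     phi [ffun b => oapp l x (unlift ord0 b)].
Proof.
rewrite pair_bigA /=.
pose h (p : T * {ffun 'I_k -> T}) : {ffun 'I_k.+1 -> T} :=
  [ffun b => oapp p.2 p.1 (unlift ord0 b)].
pose h' (l : {ffun 'I_k.+1 -> T}) : T * {ffun 'I_k -> T} :=
  (l ord0, [ffun b => l (lift ord0 b)]).
have hK : cancel h h'.
  move=> [x l]; rewrite /h' /h ffunE unlift_none; congr (_, _).
  by apply/ffunP => b; rewrite !ffunE liftK.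
have h'K : cancel h' h.
  by move=> l; apply/ffunP => b; rewrite ffunE; case: unliftP => [j|] -> /=;
    rewrite ?ffunE.
rewrite (reindex h); last by exists h' => ? _.
by apply: eq_bigr => -[].
Qed.

(** * The Capelli identity *)

(** For [s] without repetition, the sum over all [l : s -> 'I_n] of the product
    of the [X (l b) (f b)] times the product of the [D (l b) (g b)]; nesting
    the sums lets one factor be added at the outside without reordering the
    others. *)
Fixpoint normal_prod (R : pzRingType) (n : nat) (X D : 'M[R]_n) (T : Type)
    (f g : T -> 'I_n) (s : seq T) : R :=
  if s is b :: s' then
    \sum_l X l (f b) * normal_prod X D f g s' * D l (g b)
  else 1.

Section Capelli.

Variables (R : pzRingType) (n : nat) (X D : 'M[R]_n).

Hypothesis XX : forall l i k j, GRing.comm (X l i) (X k j).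
Hypothesis DD : forall l i k j, GRing.comm (D l i) (D k j).
Hypothesis DX : forall l j k i,
  D l j * X k i = X k i * D l j + ((l == k) && (j == i))%:R.

Local Notation N := (normal_prod X D).
Local Notation E := (X^T *m D).

Lemma eq_normal_prod (T : eqType) (f f' g : T -> 'I_n) (s : seq T) :
  {in s, f =1 f'} -> N f g s = N f' g s.
Proof.
elim: s => //= b s IHs ff'; rewrite ff' ?mem_head // IHs // => c cs.
by rewrite ff' // inE cs orbT.
Qed.

Lemma normal_prod_map (T U : Type) (h : U -> T) (f g : T -> 'I_n)
    (s : seq U) :
  N f g (map h s) = N (f \o h) (g \o h) s.
Proof. by elim: s => //= b s ->. Qed.

(** The derivatives [D l (g a)] of the new factor act as derivations on the
    variables of the product.  Hitting [X l' (f b)] forces [l = l'] and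
    [g a = f b], and leaves [X l' (f a)] in its place: the column index
    [f b] is replaced by [f a].  The transposition encodes this replacement,
    because the value at [a] is not read by a product over [s]. *)
Lemma polarization_normal_prod (T : finType) (f g : T -> 'I_n) (a : T)
    (s : seq T) :
  uniq (a :: s) ->
  E (f a) (g a) * N f g s =
  N f g (a :: s) +
  \sum_(b <- s) (N (f \o tperm a b) g s) *+ (g a == f b).
Proof.
elim: s => [|c s IHs] /=.
  by move=> _; rewrite big_nil addr0 mulr1 !mxE; apply: eq_bigr => l _;
    rewrite !mxE mulr1.
rewrite inE negb_or -andbA => /and4P[ac aNs cNs s_uniq].
have {}IHs := IHs (introT andP (conj aNs s_uniq)).
have step l' : E (f a) (g a) * X l' (f c) =
    X l' (f c) * E (f a) (g a) + X l' (f a) *+ (g a == f c).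
  rewrite !mxE mulr_suml mulr_sumr.
  under eq_bigr do rewrite !mxE -mulrA DX mulrDr mulrA XX -mulrA.
  under [in RHS]eq_bigr do rewrite !mxE.
  rewrite big_split /=; congr (_ + _).
  rewrite (bigD1 l') //= eqxx big1 ?addr0 ?mulr_natr //.
  by move=> i /negPf->; rewrite mulr0.
have -> : E (f a) (g a) * (\sum_l X l (f c) * N f g s * D l (g c)) =
   \sum_l X l (f c) * (E (f a) (g a) * N f g s) * D l (g c) +
   (\sum_l X l (f a) * N f g s * D l (g c)) *+ (g a == f c).
  rewrite mulr_sumr -sumrMnl -big_split /=; apply: eq_bigr => l _.
  by rewrite !mulrA step !mulrDl !mulrnAl.
rewrite IHs /= big_cons.
under eq_bigr do rewrite mulrDr mulrDl.
rewrite big_split /= -!addrA; congr (_ + _).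
  under eq_bigr do rewrite mulr_sumr mulr_suml.
  under [RHS]eq_bigr do rewrite mulr_sumr mulr_suml.
  rewrite exchange_big; apply: eq_bigr => l _; apply: eq_bigr => l' _ /=.
  by rewrite !mulrA (XX l' (f c)) -!mulrA DD.
rewrite addrC; congr (_ + _).
  congr (_ *+ _); rewrite tpermR.
  (* Here [c] itself was hit; the transposition is invisible on [s]. *)
  rewrite -(eq_normal_prod (f := f) (f' := f \o tperm a c)) // => b bs.
  by rewrite /= tpermD //; [apply: contraNneq aNs => -> |
    apply: contraNneq cNs => ->].
under eq_bigr do rewrite mulr_sumr mulr_suml.
rewrite exchange_big /= big_seq [RHS]big_seq; apply: eq_bigr => b bs.
rewrite -sumrMnl; apply: eq_bigr => l _.
rewrite tpermD ?mulrnAr ?mulrnAl //.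
by apply: contraNneq cNs => <-.
Qed.

(** Columns are put into normal order from the last to the first: in the
    intermediate sums, the columns of [p] still carry the factors of the column
    determinant, and those of [t] form a normal-ordered product. *)
Lemma capelli_normal_prod (r : nat) (i j : 'I_r -> 'I_n) :
  \sum_(s : 'S_r) (-1) ^+ s * N (i \o s) j (enum 'I_r) =
  col_det (\matrix_(a, b) (E (i a) (j b) + (r - b.+1)%:R *+ (i a == j b))).
Proof.
pose M (s : 'S_r) b := E (i (s b)) (j b) + (r - b.+1)%:R *+ (i (s b) == j b).
suff H t p : p ++ t = enum 'I_r ->
    \sum_(s : 'S_r) (-1) ^+ s * (\prod_(b <- p) M s b * N (i \o s) j t) =
    \sum_(s : 'S_r) (-1) ^+ s * \prod_(b <- enum 'I_r) M s b.
  have := H (enum 'I_r) [::] erefl.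
  under eq_bigr do rewrite big_nil mul1r.
  move=> ->; apply: eq_bigr => s _; rewrite [index_enum _]unlock -enumT.
  by under [in RHS]eq_bigr do rewrite mxE.
elim: t p => [|a t IHt] p eq_pt.
  by rewrite -eq_pt cats0; under eq_bigr do rewrite mulr1.
rewrite -(IHt (rcons p a)) ?cat_rcons //.
have : uniq (p ++ a :: t) by rewrite eq_pt enum_uniq.
rewrite cat_uniq => /and3P[p_uniq pNat at_uniq].
(* The constant of column [a] is the number of columns already normal ordered,
   that is, the number of terms it has to cancel. *)
have size_t : size t = (r - a.+1)%N.
  have size_pt : (size p + (size t).+1 = r)%N.
    by rewrite -[RHS]size_enum_ord -eq_pt size_cat.
  have size_p : size p = a.
    have : nth a (p ++ a :: t) (size p) = a by rewrite nth_cat ltnn subnn.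
    move/(congr1 val) => /= <-; rewrite eq_pt nth_enum_ord //.
    by rewrite -[ltnRHS]size_pt addnS ltnS leq_addr.
  have := congr1 (subn^~ (size p).+1) size_pt.
  by rewrite /= addnS -addSn addKn size_p.
pose Z (s : 'S_r) := \prod_(b <- p) M s b.
pose W (s : 'S_r) := N (i \o s) j t.
have expand (s : 'S_r) : (-1) ^+ s * (\prod_(b <- rcons p a) M s b * W s) =
    (-1) ^+ s * (Z s * N (i \o s) j (a :: t)) +
    ((-1) ^+ s *
       (Z s * \sum_(b <- t) (W (tperm a b * s)%g) *+ (j a == i (s b))) +
     ((-1) ^+ s * (Z s * W s)) *+ (i (s a) == j a) *+ size t).
  have -> : \prod_(b <- rcons p a) M s b = Z s * M s a.
    by rewrite -cats1 big_cat big_seq1.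
  rewrite -mulrA /M mulrDl (polarization_normal_prod (i \o s) j at_uniq).
  rewrite !mulrDr -!addrA; congr (_ + (_ + _)).
    congr (_ * (_ * _)); apply: eq_bigr => b _; congr (_ *+ _).
    by apply: eq_normal_prod => c _; rewrite /= permM.
  by rewrite -size_t mulrnAl -mulrnAr mulr_natl !mulrnAr mulrnAC.
under [RHS]eq_bigr do rewrite expand.
rewrite big_split /= -[LHS]addr0; congr (_ + _); apply/esym.
rewrite big_split /=.
under eq_bigr do rewrite !mulr_sumr.
rewrite exchange_big /=.
(* The factors in [Z] concern columns other than [a] and [b], so the change of
   variable [t := tperm a b * t] only reverses the sign. *)
have swap b : b \in t ->
    \sum_(s : 'S_r)
      (-1) ^+ s * (Z s * (W (tperm a b * s)%g *+ (j a == i (s b)))) =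
    - \sum_(s : 'S_r) ((-1) ^+ s * (Z s * W s)) *+ (i (s a) == j a).
  move=> bt; rewrite (reindex_inj (mulgI (tperm a b))) -sumrN /=.
  have ab : a != b.
    by case/andP: at_uniq => aNt _; apply: contraNneq aNt => ->.
  apply: eq_bigr => s _; rewrite mulgA tperm2 mul1g odd_mul_tperm ab.
  rewrite signr_addb expr1 mulN1r mulNr permM tpermR eq_sym !mulrnAr.
  congr (- (_ * (_ * _) *+ _)).
  rewrite /Z big_seq [RHS]big_seq; apply: eq_bigr => c cp.
  rewrite /M permM tpermD //.
    by apply: contraNneq pNat => ac; rewrite /= ac cp.
  apply: contraNneq pNat => bc; apply/hasP; exists b; last by rewrite bc.
  by rewrite inE bt orbT.
rewrite big_seq (eq_bigr _ swap) -big_seq big_const_seq count_predT.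
by rewrite iter_addr_0 sumrMnl mulNrn addNr.
Qed.

Lemma normal_prodE (r : nat) (f g : 'I_r -> 'I_n) :
  N f g (enum 'I_r) =
  \sum_(l : {ffun 'I_r -> 'I_n})
    (\prod_(b < r) X (l b) (f b)) * \prod_(b < r) D (l b) (g b).
Proof.
elim: r f g => [|r IHr] f g.
  rewrite enum_ord0 /= (bigD1 (finfun f)) //=.
  rewrite !big_ord0 mulr1 big1 ?addr0 //.
  by move=> l /eqP[]; apply/ffunP; case.
rewrite enum_ordSl /= normal_prod_map IHr big_ffun_ordS.
apply: eq_bigr => k _; rewrite mulr_sumr mulr_suml; apply: eq_bigr => l _.
rewrite !big_ord_recl !ffunE unlift_none /= -!mulrA; congr (_ * _).
under [in RHS]eq_bigr do rewrite ffunE liftK.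
under [X in _ = _ * (_ * X)]eq_bigr do rewrite ffunE liftK.
by congr (_ * _); apply/esym/commr_prod => b _; apply: DD.
Qed.

End Capelli.

(** * The Cauchy-Binet expansion *)

Lemma rsubset_nth_inj (n r : nat) (L : rsubset n r) : injective (rsubset_nth L).
Proof. by move=> a b /enum_val_inj /cast_ord_inj. Qed.

Lemma rsubset_nth_image (n r : nat) (L : rsubset n r) :
  [set rsubset_nth L a | a : 'I_r] = val L.
Proof.
apply/eqP; rewrite eqEcard card_imset ?card_ord; last exact: rsubset_nth_inj.
rewrite (eqP (valP L)) leqnn andbT.
by apply/subsetP => _ /imsetP[a _ ->]; apply: enum_valP.
Qed.

(** An injective function on ['I_r] is determined by its image [L] and by the
    order in which it visits [L]. *)
Lemma big_inj_ffun (V : nmodType) (n r : nat) (I : rsubset n r)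
    (F : {ffun 'I_r -> 'I_n} -> V) :
  (forall l : {ffun 'I_r -> 'I_n}, ~~ injectiveb l -> F l = 0) ->
  \sum_(l : {ffun 'I_r -> 'I_n}) F l =
  \sum_(L : rsubset n r) \sum_(t : 'S_r) F [ffun b => rsubset_nth L (t b)].
Proof.
move=> F0; rewrite (bigID (fun l : {ffun 'I_r -> 'I_n} => injectiveb l)) /=.
rewrite [X in _ + X]big1 // addr0.
(* [I] is only the default value of [insubd], never taken when [l] is
   injective. *)
pose im (l : {ffun 'I_r -> 'I_n}) : rsubset n r :=
  insubd I [set l b | b : 'I_r].
rewrite (partition_big im predT) //=; apply: eq_bigr => L _.
pose h (t : 'S_r) := [ffun b => rsubset_nth L (t b)] : {ffun 'I_r -> 'I_n}.
have h_inj : injective h.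
  move=> t u /ffunP tu; apply/permP => b; apply: (@rsubset_nth_inj _ _ L).
  by have := tu b; rewrite !ffunE.
have hP t : injectiveb (h t) && (im (h t) == L).
  apply/andP; split.
    apply/injectiveP => b c; rewrite !ffunE.
    by move/rsubset_nth_inj/perm_inj.
  have -> : im (h t) = insubd I (val L).
    congr insubd; rewrite -rsubset_nth_image.
    apply/setP => k; apply/imsetP/imsetP => -[b _ ->].
      by exists (t b); rewrite ?ffunE.
    by exists (t^-1%g b); rewrite ?ffunE ?permKV.
  by rewrite valKd.
rewrite (reindex h); last first.
  exists (fun l => odflt 1%g [pick t | h t == l]) => [t _|l].
    by case: pickP => [u /eqP/h_inj //|/(_ t)]; rewrite eqxx.
  rewrite inE => /andP[/injectiveP l_inj /eqP iml].
  case: pickP => [u /eqP //|noh].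
  have lL b : l b \in val L.
    rewrite -iml insubdK ?imset_f // -topredE /=.
    by rewrite card_imset ?card_ord.
  have nthl b : exists a, rsubset_nth L a == l b.
    have := lL b; rewrite -rsubset_nth_image => /imsetP[a _ ->].
    by exists a.
  pose u b := xchoose (nthl b).
  have uP b : rsubset_nth L (u b) = l b by apply/eqP/(xchooseP (nthl b)).
  have u_inj : injective u by move=> b c ubc; apply: l_inj; rewrite -!uP ubc.
  have /eqP[] := noh (perm u_inj).
  by apply/ffunP => b; rewrite ffunE permE uP.
by apply: eq_bigl => t; rewrite hP.
Qed.

(** In [\det] the factors come in the order of the rows; their
    reordering by columns is legitimate because the entries commute. *)
Lemma det_sum_colperm (R : pzRingType) (r : nat) (B : 'M[R]_r) :
  (forall a b c d, GRing.comm (B a b) (B c d)) ->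
  \det B = \sum_(t : 'S_r) (-1) ^+ t * \prod_(b < r) B (t b) b.
Proof.
move=> Bcomm; rewrite /determinant (reindex_inj invg_inj) /=.
apply: eq_bigr => t _; rewrite odd_permV; congr (_ * _).
pose F (p : 'I_r * 'I_r) := B p.1 p.2.
have -> : \prod_(i < r) B i (t^-1%g i) =
    \prod_(p <- [seq (i, t^-1%g i) | i <- index_enum 'I_r]) F p.
  by rewrite big_map.
have -> : \prod_(b < r) B (t b) b =
    \prod_(p <- [seq (t b, b) | b <- index_enum 'I_r]) F p.
  by rewrite big_map.
apply: perm_prod_comm => [p q|]; first exact: Bcomm.
apply: uniq_perm => [||[a b]].
- by rewrite map_inj_uniq ?index_enum_uniq // => a b [].
- by rewrite map_inj_uniq ?index_enum_uniq // => a b [].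
- apply/mapP/mapP => -[c _ [-> ->]].
    by exists (t^-1%g c); rewrite ?permKV.
  by exists (t c); rewrite ?permK.
Qed.

(** Alternation of determinants holds over commutative rings; hence the left
    factors are images under [phi] of a matrix over such a ring. *)
Lemma cauchy_binet (S : comPzRingType) (R : pzRingType)
    (phi : {rmorphism S -> R}) (n r : nat) (A : 'M[S]_n) (D : 'M[R]_n)
    (I J : rsubset n r) :
  (forall l i k j, GRing.comm (D l i) (D k j)) ->
  \sum_(L : rsubset n r)
     \det (minor_mx I L (map_mx phi A)^T) * \det (minor_mx L J D) =
  \sum_(l : {ffun 'I_r -> 'I_n})
     phi (\det (mxsub l (rsubset_nth I) A)) *
     \prod_(b < r) D (l b) (rsubset_nth J b).
Proof.
move=> DD; rewrite (big_inj_ffun I); last first.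
  move=> l /injectivePn[b [c bc lbc]]; rewrite (determinant_alternate bc).
    by rewrite rmorph0 mul0r.
  by move=> a; rewrite !mxE lbc.
apply: eq_bigr => L _.
rewrite (det_sum_colperm (B := minor_mx L J D)); last first.
  by move=> a b c d; rewrite !mxE; apply: DD.
rewrite mulr_sumr; apply: eq_bigr => t _.
have -> : minor_mx I L (map_mx phi A)^T =
    map_mx phi (mxsub (rsubset_nth L) (rsubset_nth I) A)^T.
  by apply/matrixP => a b; rewrite !mxE.
have -> : mxsub [ffun b => rsubset_nth L (t b)] (rsubset_nth I) A =
    row_perm t (mxsub (rsubset_nth L) (rsubset_nth I) A).
  by apply/matrixP => a b; rewrite !mxE ffunE.
rewrite det_map_mx det_tr row_permE det_mulmx det_perm rmorphM rmorph_sign.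
rewrite mulrA commr_sign; congr (_ * _).
by apply: eq_bigr => b _; rewrite mxE ffunE.
Qed.

(** * Powers of the determinant in the Weyl algebra *)

Section WeylDet.

Variables (K : fieldType) (n : nat).

Local Notation P := {mpoly K[n * n]}.
Local Notation mulop := (@weyl_mulop K n).

Fact weyl_mulop_is_zmod_morphism : zmod_morphism mulop.
Proof. by move=> f g; apply: weylP => p /=; rewrite mulN1r mulrBl. Qed.

Fact weyl_mulop_is_monoid_morphism : monoid_morphism mulop.
Proof. by split=> // f g; apply: weylP => p /=; rewrite mulrA. Qed.

HB.instance Definition _ :=
  GRing.isZmodMorphism.Build P (weyl K n) mulop weyl_mulop_is_zmod_morphism.
HB.instance Definition _ :=
  GRing.isMonoidMorphism.Build P (weyl K n) mulop
    weyl_mulop_is_monoid_morphism.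

Definition generic_mx : 'M[P]_n := \matrix_(i, j) 'X_(mxvec_index i j).

Local Notation A := generic_mx.
Local Notation X := (weylX K n).
Local Notation D := (weylD K n).

Lemma weylXE : X = map_mx mulop A.
Proof. by apply/matrixP => i j; rewrite !mxE. Qed.

Lemma mderiv_generic (l j k i : 'I_n) :
  (A k i)^`M(mxvec_index l j) = ((l == k) && (j == i))%:R.
Proof.
have idx_eq : (mxvec_index k i == mxvec_index l j) = (l == k) && (j == i).
  have idx_inj := bij_inj (onT_bij (@curry_mxvec_bij n n)).
  by rewrite (inj_eq idx_inj (k, i) (l, j)) xpair_eqE (eq_sym l) (eq_sym j).
rewrite mxE mderivX mnm1E idx_eq; case: eqP => [->|_] /=; last first.
  by rewrite scale0r.
case: eqP => [->|_]; last by rewrite scale0r.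
by rewrite -[X in (X - _)%MM]add0m addmK mpolyX0 scale1r.
Qed.

Lemma weylD_mulop (l j : 'I_n) (f : P) :
  D l j * mulop f = mulop f * D l j + mulop f^`M(mxvec_index l j).
Proof. by apply: weylP => p; rewrite !mxE /= mderivM addrC. Qed.

Lemma weylXX (l i k j : 'I_n) : GRing.comm (X l i) (X k j).
Proof. by rewrite /GRing.comm !weylXE !mxE -!rmorphM /= mulrC. Qed.

Lemma weylDD (l i k j : 'I_n) : GRing.comm (D l i) (D k j).
Proof. by apply: weylP => p; rewrite !mxE /= mderiv_comm. Qed.

Lemma weylDX (l j k i : 'I_n) :
  D l j * X k i = X k i * D l j + ((l == k) && (j == i))%:R.
Proof.
by rewrite weylXE [map_mx _ _ k i]mxE weylD_mulop mderiv_generic rmorph_nat.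
Qed.

Lemma mderiv_det_eq0 (m : nat) (B : 'M[P]_m) (v : 'I_(n * n)) :
  (forall a b, (B a b)^`M(v) = 0) -> (\det B)^`M(v) = 0.
Proof.
move=> dB0; rewrite raddf_sum big1 // => t _.
suff dprod0 : (\prod_i B i (t i))^`M(v) = 0.
  by rewrite mulr_sign; case: ifP => _; rewrite /= ?mderivN dprod0 ?oppr0.
apply: (big_ind (fun p : P => p^`M(v) = 0)) => // [|p q dp0 dq0].
  exact: mderivC.
by rewrite mderivM dp0 dq0 mul0r mulr0 addr0.
Qed.

(** The cofactors along column [j] do not involve the variables of that
    column. *)
Lemma mderiv_cofactor (l k j : 'I_n) :
  (cofactor A k j)^`M(mxvec_index l j) = 0.
Proof.
have ddet0 : (\det (row' k (col' j A)))^`M(mxvec_index l j) = 0.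
  apply: mderiv_det_eq0 => a b; rewrite [row' _ _ _ _]mxE [col' _ _ _ _]mxE.
  by rewrite mderiv_generic (negPf (neq_lift _ _)) andbF.
rewrite /cofactor -signr_odd mulr_sign.
by case: ifP => _; rewrite ?mderivN ddet0 ?oppr0.
Qed.

Lemma mderiv_det_generic (l j : 'I_n) :
  (\det A)^`M(mxvec_index l j) = cofactor A l j.
Proof.
rewrite (expand_det_col A j) raddf_sum (bigD1 l) //= big1 => [|k kl].
  by rewrite mderivM mderiv_generic !eqxx mul1r mderiv_cofactor mulr0 !addr0.
rewrite mderivM mderiv_generic mderiv_cofactor eq_sym (negPf kl).
by rewrite mul0r mulr0 addr0.
Qed.

(** This is the entry [(j, i)] of [\adj A *m A = (\det A)%:M]. *)
Lemma polarization_det (i j : 'I_n) :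
  \sum_l A l i * (\det A)^`M(mxvec_index l j) = \det A *+ (i == j).
Proof.
have /matrixP/(_ j i) := mul_adj_mx A; rewrite !mxE eq_sym => <-.
apply: eq_bigr => l _; rewrite mderiv_det_generic mulrC.
by rewrite [(\adj A) j l]mxE.
Qed.

Local Notation E := (X^T *m D).

Lemma polarization_mulop (i j : 'I_n) (f : P) :
  E i j * mulop f =
  mulop f * E i j + mulop (\sum_l A l i * f^`M(mxvec_index l j)).
Proof.
rewrite mxE mulr_suml mulr_sumr rmorph_sum -big_split /=.
apply: eq_bigr => l _; rewrite mxE weylXE [map_mx _ _ _ _]mxE -mulrA.
by rewrite weylD_mulop mulrDr !mulrA -!rmorphM /= [A l i * f]mulrC.
Qed.

(** Commutation with [\det X] adds [(i == j)%:R], once for each factor. *)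
Lemma polarization_det_exp (s : nat) (i j : 'I_n) :
  E i j * \det X ^+ s = \det X ^+ s * (E i j + s%:R *+ (i == j)).
Proof.
have -> : \det X = mulop (\det A) by rewrite weylXE det_map_mx.
elim: s => [|s IHs].
  by rewrite mulr1 mul1r mul0rn addr0.
have Edet : E i j * mulop (\det A) = mulop (\det A) * (E i j + (i == j)%:R).
  by rewrite polarization_mulop polarization_det rmorphMn mulrDr mulr_natr.
rewrite exprS mulrA Edet -!mulrA; congr (_ * _).
rewrite mulrDl IHs -commr_nat -mulrDr -addrA.
by rewrite -mulrnDl natr1.
Qed.

Lemma capelli_det_exp (r s : nat) (i j : 'I_r -> 'I_n) :
  \sum_(l : {ffun 'I_r -> 'I_n})
     mulop (\det (mxsub l i A)) * \prod_(b < r) D (l b) (j b) * \det X ^+ s =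
  \det X ^+ s *
  col_det (\matrix_(a, b) (E (i a) (j b) +
                           (s + r - b.+1)%:R *+ (i a == j b))).
Proof.
have -> : \sum_(l : {ffun 'I_r -> 'I_n})
     mulop (\det (mxsub l i A)) * \prod_(b < r) D (l b) (j b) * \det X ^+ s =
   col_det (\matrix_(a, b) (E (i a) (j b) + (r - b.+1)%:R *+ (i a == j b))) *
   \det X ^+ s.
  rewrite -(capelli_normal_prod weylXX weylDD weylDX) -mulr_suml.
  congr (_ * _).
  under [RHS]eq_bigr do rewrite (normal_prodE _ weylDD) mulr_sumr.
  rewrite exchange_big /=; apply: eq_bigr => l _.
  rewrite -det_map_mx mulr_suml; apply: eq_bigr => t _.
  rewrite mulrA weylXE; congr (_ * _ * _).
  by apply: eq_bigr => b _; rewrite !mxE.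
rewrite mulr_suml mulr_sumr; apply: eq_bigr => t _.
under eq_bigr do rewrite mxE.
under [in RHS]eq_bigr do rewrite mxE.
rewrite -mulrA (@prodr_intertwine _ _ _ _
    (fun b => E (i (t b)) (j b) + (s + r - b.+1)%:R *+ (i (t b) == j b))).
  by rewrite !mulrA commr_sign.
move=> b; rewrite mulrDl polarization_det_exp mulrnAl -commr_nat -mulrnAr.
by rewrite -mulrDr -addrA -mulrnDl -natrD addnBA.
Qed.

End WeylDet.

Theorem corollaryA3 (K : fieldType) (charK0 : [pchar K] =i pred0)
    (n s : nat) (n_gt0 : (0 < n)%N) :
  let X : 'M[weyl K n]_n := weylX K n in
  let D : 'M[weyl K n]_n := weylD K n in
  (forall (r : nat) (r_bounds : (1 <= r <= n)%N) (I J : rsubset n r),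
     \sum_(L : rsubset n r)
        \det (minor_mx I L X^T) * \det (minor_mx L J D) * \det X ^+ s
     = \det X ^+ s
       * col_det (minor_mx I J (X^T *m D) + Qcol (weyl K n) I J s))
  /\ \det X * \det D * \det X ^+ s
     = \det X ^+ s * col_det (X^T *m D + Delta_mx (weyl K n) n s).
Proof.
move=> X D.
have minors (r : nat) (I J : rsubset n r) :
    \sum_(L : rsubset n r)
      \det (minor_mx I L X^T) * \det (minor_mx L J D) * \det X ^+ s
    = \det X ^+ s
      * col_det (minor_mx I J (X^T *m D) + Qcol (weyl K n) I J s).
  have := capelli_det_exp K s (rsubset_nth I) (rsubset_nth J).
  rewrite -!mulr_suml -(cauchy_binet _ _ I J (@weylDD K n)) -weylXE => ->.
  by congr (_ * col_det _); apply/matrixP => a b; rewrite [RHS]mxE !mxE.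
split=> [r _ I J|]; first exact: minors.
(* The only subset of cardinality [n], whose minors are the whole matrices. *)
pose T : rsubset n n :=
  Sub [set: 'I_n] (introT eqP (etrans (cardsT _) (card_ord n))).
have nthT a : rsubset_nth T a = a.
  apply: val_inj; rewrite /rsubset_nth (enum_val_nth a) /=.
  by rewrite (eq_enum (in_setT (T:='I_n))) nth_enum_ord.
have minorT (R : Type) (B : 'M[R]_n) : minor_mx T T B = B.
  by apply/matrixP => a b; rewrite mxE !nthT.
have detXT : \det X^T = \det X.
  by rewrite /X weylXE matrix.map_trmx !det_map_mx det_tr.
have := minors n T T.
rewrite (big_pred1 T) => [|L]; last first.
  apply/esym/eqP/val_inj/eqP.
  by rewrite eqEcard subsetT (eqP (valP L)) cardsT card_ord leqnn.
rewrite !minorT detXT => ->; congr (_ * col_det (_ + _)).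
by apply/matrixP => a b; rewrite !mxE !nthT.
Qed.
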